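(* Let $(X,\langle\cdot,\cdot\rangle)$ be an infinite-dimensional separable real Hilbert space with norm $\|\cdot\|$. Let $f:X\to\mathbb{R}$ be a non-convex Borel function, let $r\in\,]\inf_X f,\sup_X f[$ and let $\gamma\in\,]0,+\infty]$ be such that the following four properties hold: (a) $\displaystyle \sup_{x\in X}\frac{|f(x)|}{1+\|x\|^2}<+\infty$; (b) for each $y\in X$ and each $\lambda\in\,]0,\gamma[$, the function $x\mapsto \|x-y\|^2+\lambda f(x)$ has a unique global minimum in $X$, denoted $\hat x_{y,\lambda}$; moreover, for each $\lambda\in\,]0,\gamma[$, the map $y\mapsto \hat x_{y,\lambda}$ is Borel and there is a constant $c_\lambda$, independent of $y$, such that $\|\hat x_{y,\lambda}\|\le c_\lambda(1+\|y\|)$ for all $y\in X$; (c) if $\gamma<+\infty$, then for each $y\in f^{-1}(]r,+\infty[)$ the function $x\mapsto \|x-y\|^2+\gamma f(x)$ has no global minima in $X$; (d) for each $v\in L^2([0,1],X)$ with $\int_0^1 f(v(t))\,dt>r$, the family $$\left\{\left\{u\in L^2([0,1],X):\int_0^1\|u(t)-v(t)\|^2dt+\lambda\int_0^1 f(u(t))\,dt\le\rho\right\}:\lambda\in\,]0,\gamma[,\ \rho\in\mathbb{R}\right\}$$ of subsets of $L^2([0,1],X)$ has the compactness-like property. Then the set $$\left\{u\in L^2([0,1],X):\int_0^1 f(u(t))\,dt\le r\right\}$$ is a non-convex Chebyshev set in $L^2([0,1],X)$.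
   Context: $]a,b[$ denotes the open interval with endpoints $a,b$ (possibly infinite). $L^2([0,1],X)$ is the Hilbert space of all (equivalence classes of) measurable functions $u:[0,1]\to X$ with $\int_0^1\|u(t)\|^2dt<+\infty$ ($[0,1]$ carrying Lebesgue measure), endowed with the scalar product $\langle u,v\rangle_{L^2_X}=\int_0^1\langle u(t),v(t)\rangle\,dt$ and the induced norm $\|\cdot\|_{L^2_X}$. A ''global minimum'' of a real function on a set means a point of that set at which the function attains its infimum. A non-empty subset $C$ of a real Hilbert space $H$ is a Chebyshev set if, for each $x\in H$, there exists a unique $y\in C$ such that $\|x-y\|=\inf_{z\in C}\|x-z\|$. A family $\mathcal{F}$ of subsets of a non-empty set $Y$ has the compactness-like property if every subfamily of $\mathcal{F}$ satisfying the finite intersection property has a non-empty intersection. *)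

(* Defs.v *)
From HB Require Import structures.
From mathcomp Require Import all_boot all_order all_algebra ring lra.
From mathcomp Require Import all_classical all_reals all_analysis measurable_realfun.
Import numFieldNormedType.Exports.

Set Implicit Arguments.
Unset Strict Implicit.
Unset Printing Implicit Defensive.
Import Order.TTheory GRing.Theory Num.Theory.
Local Open Scope classical_set_scope.
Local Open Scope ring_scope.

(* [{dot V for idfun}] is the library's type of symmetric bilinear positive
   definite forms on V. *)
HB.mixin Record NormedModule_isInner (R : realType) V & NormedModule R V := {
  inner : {dot V for (@idfun R)} ;
  inner_norm : forall x : V, `|x| ^+ 2 = inner x x
}.

#[short(type="innerType")]
HB.structure Definition InnerSpace (R : realType) :=
  {V of NormedModule_isInner R V & NormedModule R V}.

(* Separability is part of the structure because the vector space operations of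
   L2 depend on it: a sum of Borel measurable functions is Borel measurable when
   the codomain is separable. *)
HB.mixin Record Topological_isSeparable V & Topological V := {
  separable : exists2 D : set V, countable D & dense D
}.

#[short(type="separableHilbertType")]
HB.structure Definition SeparableHilbert (R : realType) :=
  {V of InnerSpace R V & CompleteNormedModule R V & Topological_isSeparable V}.

(* T with its Borel sigma-algebra, generated by the open sets. *)
Definition borelType (T : ptopologicalType) := g_sigma_algebraType (@open T).

Section dot.
Variables (R : realType) (U : lmodType R) (dot : {dot U for (@idfun R)}).
Implicit Types x y z : U.

Lemma dotC x y : dot x y = dot y x.
Proof. by rewrite hermC /= expr0 mul1r. Qed.

Lemma dotDl x y z : dot (x + y) z = dot x z + dot y z.
Proof. by rewrite linearDl. Qed.

Lemma dotDr x y z : dot x (y + z) = dot x y + dot x z.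
Proof. by rewrite linearDr. Qed.

Lemma dotZl a x y : dot (a *: x) y = a * dot x y.
Proof. by rewrite linearZl_LR. Qed.

Lemma dotZr a x y : dot x (a *: y) = a * dot x y.
Proof. by rewrite dotC dotZl dotC. Qed.

Lemma dot0r x : dot x 0 = 0.
Proof. by rewrite linear0r. Qed.

Lemma dot_ge0 x : 0 <= dot x x.
Proof.
have [->|x0] := eqVneq x 0; last exact/ltW/neq0_dnorm_gt0.
by rewrite dot0r.
Qed.

Lemma dot_CauchySchwarz x y : dot x y ^+ 2 <= dot x x * dot y y.
Proof.
have [->|y0] := eqVneq y 0.
  by rewrite !dot0r mulr0 expr0n.
have yy := neq0_dnorm_gt0 (s := dot) _ y0.
have := dot_ge0 (dot y y *: x + (- dot x y) *: y).
rewrite !(dotDl, dotDr, dotZl, dotZr) [dot y x]dotC.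
set a := dot x x; set b := dot x y; set c := dot y y.
rewrite [X in 0 <= X](_ : _ = c * (a * c - b ^+ 2)); last by rewrite -/a -/b -/c; ring.
by rewrite pmulr_rge0// subr_ge0.
Qed.

Lemma dot_triangle x y : Num.sqrt (dot (x + y) (x + y)) <=
  Num.sqrt (dot x x) + Num.sqrt (dot y y).
Proof.
rewrite -(@ler_pXn2r _ 2)// ?nnegrE ?addr_ge0 ?sqrtr_ge0//.
rewrite sqrrD !sqr_sqrtr ?dot_ge0// dotDl !dotDr [dot y x]dotC.
have : dot x y <= Num.sqrt (dot x x) * Num.sqrt (dot y y).
  rewrite -sqrtrM ?dot_ge0//; apply: le_trans (ler_norm _) _.
  by rewrite -sqrtr_sqr ler_wsqrtr// dot_CauchySchwarz.
set p := Num.sqrt _ * _; rewrite -mulr_natl; lra.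
Qed.

End dot.

Section borel.
Variables (R : realType) (X : separableHilbertType R).

Lemma separable_seq : exists s : nat -> X,
  forall x (e : R), 0 < e -> exists n, `|x - s n| < e.
Proof.
have [D /pfcard_geP[D0|[s]] dD] := @separable R X.
  have := dD setT; rewrite D0 setI0.
  by case=> //; [exists 0|exact: openT].
exists s => x e e0.
have [|d [/= + Dd]] := dD (ball x e) _ (ball_open _ _).
  by exists x; exact: ballxx.
rewrite -ball_normE/= => xd.
by have [n _ snd] := @surj _ _ _ _ s _ Dd; exists n; rewrite snd.
Qed.

Section measurable.
Context d (T : measurableType d) (D : set T).
Implicit Types u v : T -> borelType X.

Lemma measurable_borelP u :
  (forall x (e : R), 0 < e -> measurable (D `&` [set t | `|x - u t : X| < e])) ->
  measurable_fun D u.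
Proof.
move=> mu mD; apply: (@measurability _ _ T (borelType X) D u (@open X)) => // _ [V oV <-].
have m0 m : 0 < (m.+1%:R^-1 : R) by rewrite invr_gt0 ltr0Sn.
have [s sP] := separable_seq.
rewrite [X in measurable X](_ : _ = \bigcup_n \bigcup_m
   if `[< ball (s n) (m.+1%:R^-1 : R) `<=` V >] then
     D `&` [set t | `|s n - u t : X| < m.+1%:R^-1] else set0); last first.
  apply/seteqP; split=> t.
    move=> [Dt Vt]; have /nbhs_ballP[e/= e0 eV] := open_nbhs_nbhs (conj oV Vt).
    have [m me] : exists m, (m.+1%:R^-1 : R) < e / 2.
      have := near_infty_natSinv_lt (PosNum (divr_gt0 e0 (ltr0Sn R 1))).
      by move=> [m _ /(_ m (leqnn _))]; exists m.
    have [n sn] := sP (u t) m.+1%:R^-1 (m0 m).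
    exists n => //; exists m => //.
    case: asboolP => [_|[]]; first by split => //=; rewrite distrC.
    apply: subset_trans eV => y; rewrite -!ball_normE/= => sy.
    rewrite -(subrKA (s n)) (le_lt_trans (ler_normD _ _))// [e]splitr.
    by rewrite ltrD// (lt_trans _ me).
  move=> [n _ [m _]]; case: asboolP => // nmO [Dt/= snt]; split => //.
  by apply: nmO; rewrite -ball_normE.
apply: bigcupT_measurable => n; apply: bigcupT_measurable => m.
by case: ifPn => // _; apply: mu; rewrite invr_gt0 ltr0Sn.
Qed.

Lemma measurable_dist u x : measurable D -> measurable_fun D u ->
  forall e : R, measurable (D `&` [set t | `|x - u t : X| < e]).
Proof.
move=> mD mu e; have [e0|e0] := leP e 0.
  rewrite [X in measurable X](_ : _ = set0)// -subset0 => t [_ /=].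
  by rewrite ltNge (le_trans e0).
rewrite (_ : [set t | _] = u @^-1` (ball (x : X) e)); last by rewrite -ball_normE.
by apply: mu => //; apply: sub_sigma_algebra; exact: ball_open.
Qed.

Lemma measurable_funD_borel u v : measurable D ->
  measurable_fun D u -> measurable_fun D v ->
  measurable_fun D ((u : T -> X) + (v : T -> X) : T -> borelType X).
Proof.
move=> mD mu mv; apply: measurable_borelP => x e e0.
have m0 m : 0 < (m.+1%:R^-1 : R) by rewrite invr_gt0 ltr0Sn.
have [s sP] := separable_seq.
rewrite [X in measurable X](_ : _ = \bigcup_n \bigcup_m
   ((D `&` [set t | `|s n - u t : X| < m.+1%:R^-1]) `&`
    (D `&` [set t | `|(x - s n) - v t : X| < e - m.+1%:R^-1]))); last first.
  apply/seteqP; split=> t.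
    move=> [Dt/= xe].
    have e'0 : 0 < (e - `|x - (u + v) t|) / 2 by rewrite divr_gt0// subr_gt0.
    have [m me] : exists m, (m.+1%:R^-1 : R) < (e - `|x - (u + v) t|) / 2.
      have := near_infty_natSinv_lt (PosNum e'0).
      by move=> [m _ /(_ m (leqnn _))]; exists m.
    have [n sn] := sP (u t) m.+1%:R^-1 (m0 m).
    exists n => //; exists m => //; split; split => //=; first by rewrite distrC.
    rewrite (_ : x - s n - v t = (x - (u + v) t) + (u t - s n)); last first.
      by rewrite /= opprD [x + (- u t - _)]addrA [RHS]addrAC subrKA.
    apply: le_lt_trans (ler_normD _ _) _; rewrite ltrBrDl.
    have aux (k p q c : R) : k < (c - p) / 2 -> q < k -> k + (p + q) < c by lra.
    exact: aux me sn.
  move=> [n _ [m _ [[Dt/= h1] [_ /= h2]]]]; split => //=.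
  rewrite (_ : x - _ = (x - s n - v t) + (s n - u t)); last first.
    by rewrite [RHS]addrAC subrKA /= opprD addrA.
  apply: le_lt_trans (ler_normD _ _) _.
  by rewrite -[e](subrK m.+1%:R^-1) ltrD.
apply: bigcupT_measurable => n; apply: bigcupT_measurable => m.
by apply: measurableI; exact: measurable_dist.
Qed.

Lemma measurable_funZ_borel (a : R) u : measurable D -> measurable_fun D u ->
  measurable_fun D (a *: (u : T -> X) : T -> borelType X).
Proof.
move=> mD mu; have [->|a0] := eqVneq a 0.
  rewrite (_ : _ *: _ = cst (0 : borelType X)) ?scale0r//.
apply: measurable_borelP => x e e0.
rewrite (_ : [set _ | _] = [set t | `|a^-1 *: x - u t : X| < `|a|^-1 * e]).
  exact: measurable_dist.
apply/seteqP; split => t /=; rewrite -[x in `|x - a *: _|](scalerKV a0);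
  rewrite -scalerBr normrZ ltr_pdivlMl ?normr_gt0//.
Qed.

Lemma measurable_norm_borel u : measurable_fun D u ->
  measurable_fun D (fun t => `|u t : X|).
Proof.
move=> mu mD.
apply: (measurability _ (RGenInftyO.measurableE R)) => // _ [_ [a ->] <-].
rewrite [X in measurable X](_ : _ = D `&` [set t | `|0 - u t : X| < a]).
  exact: measurable_dist.
by congr setI; apply/seteqP; split => t /=; rewrite in_itv/= sub0r normrN.
Qed.

End measurable.
End borel.

Section l2fun.
Variables (R : realType) (X : separableHilbertType R).
Local Notation leb := (@lebesgue_measure R).

(* Functions on [0, 1] are encoded as functions on R of which only the
   restriction to [0, 1] matters: measurability, integrals and almost everywhere
   equality are all relative to [unit_itv]. *)
Definition unit_itv : set R := `[0%R, 1%R]%classic.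
Local Notation I := unit_itv.

Lemma measurable_unit_itv : measurable (I : set (measurableTypeR R)).
Proof. exact: measurable_itv. Qed.
Local Notation mI := measurable_unit_itv.

(* The library's Lebesgue measure lives on the Borel sets of R, so measurable
   means Borel measurable here. As X is separable, every Lebesgue measurable
   function is almost everywhere equal to a Borel one, and the equivalence
   classes below are the same. *)
Definition l2pred : {pred R -> X} := fun u =>
  `[< measurable_fun I (u : measurableTypeR R -> borelType X) /\
      (\int[leb]_(t in I) (`|u t| ^+ 2)%:E < +oo)%E >].

Lemma measurable_sqr_norm (u : measurableTypeR R -> borelType X) : measurable_fun I u ->
  measurable_fun I (fun t => (`|u t : X| ^+ 2)%:E).
Proof.
move=> mu; apply/measurable_EFinP; apply: measurable_funX.
exact: measurable_norm_borel.
Qed.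

Lemma l2predP (u : R -> X) :
  reflect (measurable_fun I (u : measurableTypeR R -> borelType X) /\
           leb.-integrable I (fun t => (`|u t| ^+ 2)%:E)) (u \in l2pred).
Proof.
have abs t : `|(`|u t| ^+ 2)%:E|%E = (`|u t| ^+ 2)%:E.
  by rewrite gee0_abs// lee_fin sqr_ge0.
apply: (iffP (asboolP _)) => -[mu iu]; split => //.
  apply/integrableP; split; first exact: measurable_sqr_norm.
  by under eq_integral do rewrite abs.
by move/integrableP : iu => [_]; under eq_integral do rewrite abs.
Qed.

Lemma l2pred_submod_closed : submod_closed l2pred.
Proof.
split.
  apply/asboolP; split; first exact: (@measurable_cst _ _ _ _ _ (0 : borelType X)).
  under eq_integral do rewrite normr0 expr0n/=.
  by rewrite integral0.
move=> a u v /l2predP[mu iu] /l2predP[mv iv]; apply/l2predP.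
have mw : measurable_fun I (a *: u + v : measurableTypeR R -> borelType X).
  apply: measurable_funD_borel => //; first exact: mI.
  by apply: measurable_funZ_borel => //; exact: mI.
have ig : leb.-integrable I
    (fun t => (2 * a ^+ 2 * `|u t| ^+ 2 + 2 * `|v t| ^+ 2)%:E).
  rewrite (_ : (fun _ => _) =
      ((fun t => (2 * a ^+ 2)%:E * (`|u t| ^+ 2)%:E) \+
       (fun t => 2%:E * (`|v t| ^+ 2)%:E))%E); last first.
    by apply/funext => t; rewrite EFinD (EFinM (2 * a ^+ 2)) (EFinM 2).
  by apply: (@integrableD _ _ _ leb); [exact: mI|apply: integrableZl => //; exact: mI..].
split=> //; apply: le_integrable ig => //.
- exact: mI.
- exact: (measurable_sqr_norm mw).
move=> t _; rewrite !abse_EFin lee_fin !ger0_norm ?(sqr_ge0, addr_ge0, mulr_ge0)//.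
have := ler_normD (a *: u t) (v t); rewrite normrZ => h.
apply: (@le_trans _ _ ((`|a| * `|u t| + `|v t|) ^+ 2)).
  by rewrite ler_pXn2r// nnegrE ?addr_ge0 ?mulr_ge0.
rewrite -(real_normK (num_real a)).
by move: `|a| `|u t| `|v t| => p q s; have := sqr_ge0 (p * q - s); lra.
Qed.

HB.instance Definition _ := GRing.isSubmodClosed.Build R (R -> X) l2pred
  l2pred_submod_closed.

Record l2fun := L2Fun { l2fun_val :> R -> X ; l2fun_valP : l2fun_val \in l2pred }.

HB.instance Definition _ := [isSub for l2fun_val].
HB.instance Definition _ := [Choice of l2fun by <:].
HB.instance Definition _ := [SubChoice_isSubLmodule of l2fun by <:].

Lemma l2funP (a : R) (u v : l2fun) :
  l2fun_val (a *: u + v) = a *: (u : R -> X) + (v : R -> X).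
Proof. by []. Qed.

Definition l2null : {pred l2fun} := fun u => `[< u = cst 0 %[ae leb in I] >].

Lemma l2null_submod_closed : submod_closed l2null.
Proof.
split; first by apply/asboolP; exact: aeW.
move=> a u v /asboolP u0 /asboolP v0; apply/asboolP.
apply: (@filterS2 _ _ (ae_filter_ringOfSetsType leb) _ _ _ _ u0 v0) => t ut vt It.
by rewrite l2funP -[LHS]/(a *: u t + v t) ut// vt// scaler0 addr0.
Qed.

HB.instance Definition _ := GRing.isSubmodClosed.Build R l2fun l2null
  l2null_submod_closed.

(* Equivalence classes of square integrable functions modulo almost everywhere
   equality on [0, 1]. *)
Definition L2 := {ideal_quot l2null}.

HB.instance Definition _ := Choice.on L2.
HB.instance Definition _ := EqQuotient.on L2.
HB.instance Definition _ := GRing.Zmodule.on L2.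

(* A representative of the class, inserted as a coercion; the quantities defined
   from it below do not depend on the choice, by [l2repr_pi] and [L2_eqP]. *)
Definition l2repr (u : L2) : R -> X := repr u.
End l2fun.
Arguments unit_itv R : clear implicits.
Coercion l2repr : L2 >-> Funclass.

Section L2_lmodule.
Variables (R : realType) (X : separableHilbertType R).
Local Notation leb := (@lebesgue_measure R).
Local Notation I := (unit_itv R).
Local Notation mI := (@measurable_unit_itv R).
Local Notation L2 := (@L2 R X).
Local Open Scope quotient_scope.
Local Notation aeF := (ae_filter_ringOfSetsType leb).

Lemma l2repr_pi (u : l2fun X) : l2repr (\pi_L2 u) = u %[ae leb in I].
Proof.
have : (repr (\pi_L2 u) - u)%R \in @l2null R X.
  by rewrite Quotient.idealrBE; apply/eqP; rewrite reprK.
move/asboolP; apply: (@filterS _ _ aeF) => t ut It; apply/eqP; rewrite -subr_eq0; apply/eqP.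
by have := ut It.
Qed.

Lemma L2_eqP (u v : L2) : u = v <-> (l2repr u = l2repr v %[ae leb in I]).
Proof.
split=> [->|uv]; first exact: ae_eq_refl.
rewrite -[u]reprK -[v]reprK; apply/eqP; rewrite -Quotient.idealrBE.
apply/asboolP; apply: (@filterS _ _ aeF _ _ _ uv) => t uvt It.
by apply/eqP; rewrite -[_ == _]/(l2repr u t - l2repr v t == 0) subr_eq0 uvt.
Qed.

Definition l2scale (a : R) : L2 -> L2 := lift_op1 L2 ( *:%R a).

Lemma pi_l2scale a : {morph \pi_L2 : u / (a *: u)%R >-> l2scale a u}.
Proof.
move=> u; unlock l2scale; apply/eqP; rewrite -Quotient.idealrBE -scalerBr.
by rewrite rpredZ// Quotient.idealrBE reprK.
Qed.

Lemma pi_l2D : {morph \pi_L2 : u v / (u + v)%R >-> (u + v)%R}.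
Proof. exact: Quotient.pi_add. Qed.

Lemma pi_l20 : \pi_L2 0%R = 0%R.
Proof. by rewrite [RHS]/0%R/= /Quotient.zero; unlock. Qed.

Lemma l2scaleA a b u : l2scale a (l2scale b u) = l2scale (a * b) u.
Proof. by rewrite -[u]reprK -!pi_l2scale scalerA. Qed.

Lemma l2scale1 : left_id 1 l2scale.
Proof. by move=> u; rewrite -[u]reprK -pi_l2scale scale1r. Qed.

Lemma l2scaleDr : right_distributive l2scale +%R.
Proof.
move=> a u v; rewrite -[u]reprK -[v]reprK.
by rewrite -!pi_l2scale -!pi_l2D -pi_l2scale scalerDr.
Qed.

Lemma l2scaleDl u : {morph l2scale^~ u : a b / a + b}.
Proof.
move=> a b; rewrite -[u]reprK -!pi_l2scale -!pi_l2D.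
by rewrite scalerDl.
Qed.

HB.instance Definition _ := GRing.Zmodule_isLmodule.Build R L2
  l2scaleA l2scale1 l2scaleDr l2scaleDl.

Lemma L2P (a : R) (u v : L2) :
  l2repr (a *: u + v) = a *: (u : R -> X) + (v : R -> X) %[ae leb in I].
Proof.
have -> : a *: u + v = \pi_L2 (a *: repr u + repr v)%R.
  by rewrite pi_l2D pi_l2scale !reprK.
exact: l2repr_pi.
Qed.

Lemma l2repr_measurable (u : L2) : measurable_fun I (u : measurableTypeR R -> borelType X).
Proof. by have /l2predP[] := l2fun_valP (repr u). Qed.

Lemma l2repr_integrable (u : L2) :
  leb.-integrable I (fun t => (`|u t| ^+ 2)%:E).
Proof. by have /l2predP[] := l2fun_valP (repr u). Qed.

Definition l2dot (u v : L2) : R := \int[leb]_(t in I) inner (u t) (v t).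

Lemma innerE (x y : X) :
  inner x y = 4^-1 * (`|x + y| ^+ 2 - `|(-1) *: y + x| ^+ 2).
Proof.
rewrite !inner_norm !(dotDl, dotDr) !(dotZl, dotZr) (dotC inner y x).
by field.
Qed.

Lemma l2dot_integrable (u v : L2) :
  leb.-integrable I (fun t => (inner (u t) (v t))%:E).
Proof.
under eq_fun do rewrite innerE EFinM EFinB.
apply: integrableZl; first exact: mI.
apply: integrableB; first exact: mI.
  have /l2predP[] : (repr u : R -> X) + (repr v : R -> X) \in @l2pred R X.
    by rewrite rpredD// l2fun_valP.
  by [].
have /l2predP[] : (-1) *: (repr v : R -> X) + (repr u : R -> X) \in @l2pred R X.
  by rewrite rpredD ?rpredZ// l2fun_valP.
by [].
Qed.

Lemma l2dotC u v : l2dot u v = l2dot v u.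
Proof. by apply: eq_Rintegral => t _; rewrite dotC. Qed.

Lemma l2dotP a u v w : l2dot (a *: u + v) w = a * l2dot u w + l2dot v w.
Proof.
rewrite -RintegralZl//; [|exact: mI|exact: l2dot_integrable].
rewrite -RintegralD//; [|exact: mI| |exact: l2dot_integrable]; last first.
  exact: (@integrableZl _ _ _ leb I mI a _ (l2dot_integrable u w)).
congr fine; apply: ae_eq_integral.
- exact: mI.
- exact: measurable_int (l2dot_integrable _ _).
- under eq_fun do rewrite EFinD EFinM.
  apply: emeasurable_funD.
    apply: measurable_funeM; exact: measurable_int (l2dot_integrable _ _).
  exact: measurable_int (l2dot_integrable _ _).
apply: (@filterS _ _ aeF _ _ _ (L2P a u v)) => t /[apply] ->.
by rewrite -dotZl -dotDl.
Qed.

Lemma l2dot_zmod_morphism w : zmod_morphism (l2dot ^~ w).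
Proof.
move=> u v; rewrite -[v in u - v](scale1r) addrC -scaleNr l2dotP.
by rewrite mulN1r addrC.
Qed.

Lemma l2dot_scalable w : scalable_for *%R (l2dot ^~ w).
Proof.
have l0 : l2dot 0 w = 0.
  by have := l2dotP (-1) 0 0 w; rewrite scaler0 addr0 mulN1r addNr.
by move=> a u; have := l2dotP a u 0 w; rewrite l0 !addr0.
Qed.

HB.instance Definition _ := isBilinear.Build R L2 L2 R *%R (idfun \; *%R) l2dot
  l2dot_zmod_morphism
  (fun u v w => etrans (etrans (l2dotC _ _) (l2dot_zmod_morphism _ _ _))
     (f_equal2 _ (l2dotC _ _) (f_equal _ (l2dotC _ _))))
  l2dot_scalable
  (fun u a v => etrans (etrans (l2dotC _ _) (l2dot_scalable _ _ _))
     (f_equal _ (l2dotC _ _))).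

HB.instance Definition _ := isHermitianSesquilinear.Build R L2 false idfun l2dot
  (fun u v => etrans (l2dotC u v) (esym (mul1r _))).

Lemma l2dot_gt0 u : u != 0 -> 0 < l2dot u u.
Proof.
move=> u0; have l0 : 0 <= l2dot u u.
  by apply: Rintegral_ge0 => t _; exact: dot_ge0.
rewrite lt_neqAle l0 andbT; apply: contra_neq u0 => u0.
have u_ae : (fun t => (inner (l2repr u t) (l2repr u t))%:E) = cst 0%E %[ae leb in I].
  apply/(@ae_eq_integral_abs _ _ _ leb _ mI).
    exact: measurable_int (l2dot_integrable _ _).
  under eq_integral do rewrite gee0_abs ?lee_fin ?dot_ge0//.
  rewrite -[LHS]fineK; first by rewrite -[fine _]/(l2dot u u) -u0.
  exact: (integrable_fin_num mI (l2dot_integrable u u)).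
apply: (proj2 (L2_eqP u 0)).
have -> : l2repr (0 : L2) = l2repr (\pi_L2 0%R) by rewrite pi_l20.
apply: (@filterS2 _ _ aeF _ _ _ _ u_ae (l2repr_pi 0)) => t ut z It; rewrite z//.
have [] := ut It; rewrite -inner_norm => /eqP.
by rewrite sqrf_eq0 normr_eq0 => /eqP.
Qed.

HB.instance Definition _ := isDotProduct.Build R L2 l2dot l2dot_gt0.

Let l2norm (u : L2) : R := Num.sqrt (l2dot u u).

Let l2normD u v : l2norm (u + v) <= l2norm u + l2norm v.
Proof. exact: dot_triangle. Qed.

Let l2normZ a u : l2norm (a *: u) = `|a| * l2norm u.
Proof.
by rewrite /l2norm dotZl dotZr mulrA -expr2 sqrtrM ?sqr_ge0// sqrtr_sqr.
Qed.

Let l2norm0_eq0 u : l2norm u = 0 -> u = 0.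
Proof.
move=> u0; apply: contra_eq u0 => u0.
by rewrite gt_eqF// sqrtr_gt0 l2dot_gt0.
Qed.

HB.instance Definition _ := Lmodule_isNormed.Build R L2
  l2normD l2normZ l2norm0_eq0.

Let l2norm_dot (u : L2) : `|u| ^+ 2 = l2dot u u.
Proof. by rewrite sqr_sqrtr// dot_ge0. Qed.

HB.instance Definition _ := NormedModule_isInner.Build R L2 l2norm_dot.

End L2_lmodule.

Definition infinite_dimensional (R : realType) (V : lmodType R) :=
  ~ exists (n : nat) (e : 'I_n -> V), forall x : V,
      exists a : 'I_n -> R, x = \sum_(i < n) a i *: e i.

(* [x] is a point at which [F] attains its infimum. *)
Definition global_minimum (R : realType) (T : Type) (F : T -> R) (x : T) :=
  (F x)%:E = ereal_inf [set (F z)%:E | z in [set: T]].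

Definition chebyshev_set (R : realType) (H : innerType R) (C : set H) :=
  C !=set0 /\
  forall x : H, exists! y, C y /\ `|x - y| = inf [set `|x - z| | z in C].

(* [finI G id]: all finite subfamilies of G have a nonempty intersection. *)
Definition compactness_like (Y : Type) (F : set (set Y)) :=
  forall G : set (set Y), G `<=` F -> finI G id -> \bigcap_(A in G) A !=set0.

(* Main.v *)
(* Write J u for the integral of f (u t), and let w l be the minimizer over u of
   |u - v|^2 + l * J u, obtained by applying xhat pointwise. If J v > r, every l
   with J (w l) = r makes w l the unique point of {J <= r} nearest to v. Such an l
   is the infimum of {l | J (w l) <= r}: if J (w l) stays on one side of r on an
   interval of values of l, then the sublevel sets of |u - v|^2 + l * J u at
   heights affine in l with slope r are nested along the w l, and a common point
   given by (d) is a minimizer at the end of the interval with J on the same side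
   of r. At 0 this minimizer would be v, at gamma it would contradict (c).

   For the nonconvexity, two step functions that exchange the values x and y on two
   halves of a small interval, completed so that J = r, have an average with
   value (x + y) / 2 on that interval. Convexity of {J <= r} thus forces f to be
   midpoint convex, hence convex because (a) bounds it on segments. *)

Require Import Defs.
From mathcomp Require Import all_boot all_order all_algebra.
From mathcomp Require Import all_classical all_reals all_analysis.
From mathcomp Require Import finmap lra ring measurable_realfun.
Import numFieldNormedType.Exports.
Import Order.TTheory GRing.Theory Num.Theory.
Local Open Scope classical_set_scope.
Local Open Scope ring_scope.

Set Implicit Arguments.
Unset Strict Implicit.

Local Notation leb := lebesgue_measure.

(** * Minimizers of N + l J at the ends of an interval of multipliers *)

Lemma affine_ge_left_endpoint (R : realType) (a b p q k : R) : a < b ->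
  (forall l, a < l < b -> k <= p + l * q) -> k <= p + a * q.
Proof.
move=> ab H; rewrite leNgt; apply/negP => lt_k.
have d0 : 0 < k - (p + a * q) by rewrite subr_gt0.
have q0 : 0 < 1 + `|q| by rewrite ltr_pwDl.
(* The first term keeps a + e inside ]a, b[; the second makes e |q| at most half the gap, so the
   assumed inequality fails at a + e. *)
pose e := Num.min ((b - a) / 2) ((k - (p + a * q)) / (1 + `|q|) / 2).
have e0 : 0 < e by rewrite lt_min !divr_gt0// subr_gt0.
have eb : e <= (b - a) / 2 by rewrite ge_min lexx.
have ed : e * (1 + `|q|) <= (k - (p + a * q)) / 2.
  by rewrite -ler_pdivlMr// mulrAC ge_min lexx orbT.
have le : e * q <= e * `|q| by rewrite ler_pM2l// ler_norm.
have := H (a + e); rewrite mulrDl => /(_ _)/wrap[]; first by lra.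
lra.
Qed.

Lemma affine_le_left_endpoint (R : realType) (a b p q k : R) : a < b ->
  (forall l, a < l < b -> p + l * q <= k) -> p + a * q <= k.
Proof.
move=> ab H; rewrite -lerN2 opprD -mulrN; apply: affine_ge_left_endpoint ab _ => l lab.
by rewrite mulrN -opprD lerN2 H.
Qed.

(* Let L be the supremum over l of the minimum of N + l (J - s). If the slopes
   J (w l) are at most s, the sublevel set of N + l (J - s) at height L contains
   w l' for all l' <= l, so these sets have the finite intersection property. *)
Lemma minimizer_left_endpoint (R : realType) (U : Type) (N J : U -> R)
    (w : R -> U) (a b s : R) : a < b ->
  (forall l, a < l < b -> forall u, N (w l) + l * J (w l) <= N u + l * J u) ->
  (forall l, a < l < b -> J (w l) <= s) ->
  compactness_like [set A : set U | exists l rho : R,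
    a < l < b /\ A = [set u | N u + l * J u <= rho]] ->
  exists u, (forall z, N u + a * J u <= N z + a * J z) /\ J u <= s.
Proof.
move=> ab wmin ws cpt.
pose G l u := N u + l * (J u - s).
have GE l u : G l u = N u + l * J u - l * s by rewrite /G; ring.
have Gmin l u : a < l < b -> G l (w l) <= G l u.
  by move=> lab; rewrite !GE lerD2r wmin.
(* Test the minimality of [w l] at [w l'], where the slope J - s is at most 0: raising the
   multiplier from l' to l does not increase G there. *)
have Gdec l l' : a < l' -> l' <= l -> l < b -> G l (w l) <= G l' (w l').
  move=> al ll lb; apply: (le_trans (Gmin _ (w l') _)); first by lra.
  rewrite /G lerD2l ler_wnM2r// subr_le0 ws//; lra.
pose m := (a + b) / 2.
have mab : a < m < b by rewrite /m; lra.
pose V := [set G l (w l) | l in [set l | a < l < b]].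
(* For l' below l, the minimum at l is at most the minimum at l', hence at most [G l' z]; let l'
   tend to a. *)
have Gz l z : a < l < b -> G l (w l) <= G a z.
  move=> lab; apply: (@affine_ge_left_endpoint _ _ l) => [|l' lab']; first by lra.
  apply: (@le_trans _ _ (G l' (w l'))); first by apply: Gdec; lra.
  by apply: Gmin; lra.
have Vub : has_ubound V by exists (G a (w m)) => _ [l /= lab <-]; exact: Gz.
have Vl l : a < l < b -> G l (w l) <= sup V.
  by move=> lab; apply: ub_le_sup => //; exists l.
have supV z : sup V <= G a z.
  apply: ge_sup; first by exists (G m (w m)), m.
  by move=> _ [l /= lab <-]; exact: Gz.
pose S := [set A : set U | exists l, a < l < b /\ A = [set u | G l u <= sup V]].
have [||u uS] := cpt S.
- move=> _ [l [lab ->]]; exists l, (sup V + l * s); split => //.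
  by apply/seteqP; split => u /=; rewrite GE lerBlDr.
- move=> D DS.
  suff [l0 [lab0 wD]] : exists l0, a < l0 < b /\
      forall A, A \in enum_fset D -> A (w l0).
    by exists (w l0) => A /= /wD.
  have : forall A, A \in enum_fset D -> S A by move=> A /DS /set_mem.
  (* Asking for every l in ]a, l0], not just l0, lets the induction pass to the smaller of two
     parameters. *)
  suff gen (s' : seq (set U)) : (forall A, A \in s' -> S A) -> exists l0, a < l0 < b /\
      forall A, A \in s' -> forall l, a < l <= l0 -> A (w l).
    move=> /gen[l0 [lab0 H]]; exists l0; split => // A /H; apply.
    by case/andP : lab0 => ->/=.
  elim: s' => [_|B s' IH HS]; first by exists m.
  have [|l0 [lab0 H]] := IH; first by move=> A As; apply: HS; rewrite inE As orbT.
  have [l [lab BE]] : S B by apply: HS; rewrite inE eqxx.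
  exists (Num.min l0 l); split; first by rewrite lt_min gt_min; lra.
  move=> A; rewrite inE => /orP[/eqP -> l'|As l']; rewrite le_min => /and3P[al ll0 ll].
    rewrite BE/=; apply: le_trans (Vl l' _); last by lra.
    by rewrite /G lerD2l ler_wnM2r// subr_le0 ws//; lra.
  by apply: H => //; rewrite al.
have Gu l : a < l < b -> G l u <= sup V.
  by move=> lab; apply: (uS [set u | G l u <= sup V]); exists l.
have Gau : G a u <= sup V by exact: affine_le_left_endpoint ab Gu.
exists u; split.
  by move=> z; have := le_trans Gau (supV z); rewrite !GE lerD2r.
(* [G m u <= sup V <= G a u] with a < m, and G is affine in l with slope J u - s, so this slope
   cannot be positive. *)
have := le_trans (Gu m mab) (supV u); rewrite /G lerD2l => h.
rewrite -subr_le0 leNgt; apply/negP => Js0.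
by move: h; rewrite ler_pM2r//; lra.
Qed.

(** The reflection l to -l, J to -J, s to -s exchanges the two ends of the interval and leaves l J
    unchanged. *)
Lemma minimizer_right_endpoint (R : realType) (U : Type) (N J : U -> R)
    (w : R -> U) (a b s : R) : a < b ->
  (forall l, a < l < b -> forall u, N (w l) + l * J (w l) <= N u + l * J u) ->
  (forall l, a < l < b -> s <= J (w l)) ->
  compactness_like [set A : set U | exists l rho : R,
    a < l < b /\ A = [set u | N u + l * J u <= rho]] ->
  exists u, (forall z, N u + b * J u <= N z + b * J z) /\ s <= J u.
Proof.
move=> ab wmin ws cpt.
have [||||u [umin us]] := @minimizer_left_endpoint R U N (\- J) (w \o -%R) (- b) (- a) (- s).
- by rewrite ltrN2.
- by move=> l lab u /=; rewrite !mulrN -!mulNr; apply: wmin; lra.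
- by move=> l lab /=; rewrite lerN2; apply: ws; lra.
- move=> S SA; apply: cpt => A /SA[l [rho [lab ->]]]; exists (- l), rho; split; first by lra.
  by apply/seteqP; split => u /=; rewrite mulrN -mulNr.
exists u; split; last by rewrite -lerN2.
by move=> z; have := umin z; rewrite /= !mulrNN.
Qed.

(** * Almost everywhere comparison of integrals on [0, 1] *)

(** The nonnegative function h - g has integral zero, so it vanishes almost everywhere. This turns
    equality of minimal integrals into pointwise information. *)
Lemma ae_eq_of_ge_Rintegral (R : realType) (g h : R -> R) :
  (@leb R).-integrable (unit_itv R) (EFin \o g) ->
  (@leb R).-integrable (unit_itv R) (EFin \o h) ->
  (forall t, unit_itv R t -> g t <= h t) ->
  \int[leb]_(t in unit_itv R) h t <= \int[leb]_(t in unit_itv R) g t ->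
  g = h %[ae leb in unit_itv R].
Proof.
move=> ig ih gh hg; have mI := @measurable_unit_itv R.
have ihg : (@leb R).-integrable (unit_itv R) (EFin \o (h \- g)).
  by rewrite (_ : _ \o _ = (EFin \o h) \- (EFin \o g))%E//; exact: integrableB.
have i0 : \int[leb]_(t in unit_itv R) (h t - g t) = 0.
  apply/eqP; rewrite eq_le Rintegral_ge0 ?andbT; last first.
    by move=> t It; rewrite subr_ge0 gh.
  by rewrite RintegralB// subr_le0.
have hg0 : (EFin \o (h \- g)) = cst 0%E %[ae leb in unit_itv R].
  apply/(@ae_eq_integral_abs _ _ _ leb _ mI); first exact: measurable_int ihg.
  rewrite (@eq_integral _ _ _ leb _ (EFin \o (h \- g))%R); last first.
    by move=> t /set_mem It; rewrite gee0_abs// lee_fin subr_ge0 gh.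
  rewrite -[LHS]fineK; first by congr EFin; exact: i0.
  exact: (integrable_fin_num mI ihg).
apply: (@filterS _ _ (ae_filter_ringOfSetsType leb) _ _ _ hg0) => t ht It.
by have [/eqP] := ht It; rewrite subr_eq0 => /eqP.
Qed.

Lemma eq_Rintegral_ae (R : realType) (g h : R -> R) :
  (@leb R).-integrable (unit_itv R) (EFin \o g) -> (@leb R).-integrable (unit_itv R) (EFin \o h) ->
  g = h %[ae leb in unit_itv R] ->
  \int[leb]_(t in unit_itv R) g t = \int[leb]_(t in unit_itv R) h t.
Proof.
move=> ig ih gh; congr fine; apply: ae_eq_integral.
- exact: measurable_unit_itv.
- exact: measurable_int ig.
- exact: measurable_int ih.
by apply: (@filterS _ _ (ae_filter_ringOfSetsType leb) _ _ _ gh) => t /[apply] /= ->.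
Qed.

(** Replacing g by min(g, h), equal to it almost everywhere, makes the inequality hold at every
    point. *)
Lemma ae_le_Rintegral (R : realType) (g h : R -> R) :
  (@leb R).-integrable (unit_itv R) (EFin \o g) ->
  (@leb R).-integrable (unit_itv R) (EFin \o h) ->
  (\forall t \ae leb, unit_itv R t -> g t <= h t) ->
  \int[leb]_(t in unit_itv R) g t <= \int[leb]_(t in unit_itv R) h t.
Proof.
move=> ig ih gh; have mI := @measurable_unit_itv R.
have im : (@leb R).-integrable (unit_itv R) (EFin \o (fun t => Num.min (g t) (h t))).
  have igh : (@leb R).-integrable (unit_itv R) ((abse \o (EFin \o g)) \+ (abse \o (EFin \o h)))%E.
    by apply: integrableD => //; exact: integrable_abse.
  apply: le_integrable igh => //.
    apply/measurable_EFinP; apply: measurable_minr; apply/measurable_EFinP.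
      exact: measurable_int ig.
    exact: measurable_int ih.
  move=> t _ /=; rewrite lee_fin [leRHS]ger0_norm ?addr_ge0//.
  by rewrite /Num.min; case: ifP => _; rewrite ?lerDl ?lerDr.
rewrite (@eq_Rintegral_ae _ g (fun t => Num.min (g t) (h t)))//.
  by apply: le_Rintegral => // t _; rewrite ge_min lexx orbT.
by apply: (@filterS _ _ (ae_filter_ringOfSetsType leb) _ _ _ gh) => t ght It; rewrite min_l ?ght.
Qed.

(** * The penalized integral functional on square integrable functions *)

Section L2_functional.
Variables (R : realType) (X : separableHilbertType R).
Implicit Types u v w : R -> X.

Local Notation I := (unit_itv R).
Local Notation mI := (@measurable_unit_itv R).
Local Notation aeF := (ae_filter_ringOfSetsType (@leb R)).
Local Notation SqInt := (@l2pred R X).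
Local Notation mfun u := (measurable_fun I (u : measurableTypeR R -> borelType X)).

Lemma integrable_cst_unit_itv (k : R) : (@leb R).-integrable I (fun=> k%:E).
Proof.
apply/integrableP; split; first exact: measurable_cst.
rewrite integral_cst/=; last exact: mI.
by rewrite lebesgue_measure_itv/= lte01 oppr0 adde0 mule1 ltry.
Qed.

Lemma l2pred_le u (g : R -> R) : mfun u -> (@leb R).-integrable I (EFin \o g) ->
  (forall t, I t -> `|u t| ^+ 2 <= g t) -> u \in SqInt.
Proof.
move=> mu ig ug; apply/l2predP; split => //.
apply: le_integrable ig; [exact: mI|exact: measurable_sqr_norm|].
move=> t It; rewrite !abse_EFin lee_fin ger0_norm ?sqr_ge0//.
by apply: le_trans (ug t It) _; exact: ler_norm.
Qed.

Lemma integrable_affine_sqr_norm u (k1 k2 : R) : u \in SqInt ->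
  (@leb R).-integrable I (EFin \o (fun t => k1 + k2 * `|u t| ^+ 2)).
Proof.
move=> /l2predP[mu iu].
rewrite (_ : _ \o _ = (cst k1%:E \+ (fun t => k2%:E * (`|u t| ^+ 2)%:E))%E).
  apply: (@integrableD _ _ _ leb); [exact: mI|exact: integrable_cst_unit_itv|].
  by apply: integrableZl => //; exact: mI.
by apply/funext => t /=; rewrite EFinD EFinM.
Qed.

Lemma l2pred_cst (x : X) : cst x \in SqInt.
Proof.
apply: (@l2pred_le _ (fun=> `|x| ^+ 2)); last by [].
  exact: (@measurable_cst _ _ (measurableTypeR R) (borelType X) I x).
exact: integrable_cst_unit_itv.
Qed.

Lemma l2pred_comp u (h : X -> X) (c : R) :
  measurable_fun [set: borelType X] (h : borelType X -> borelType X) ->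
  (forall y, `|h y| <= c * (1 + `|y|)) -> u \in SqInt -> h \o u \in SqInt.
Proof.
move=> mh hc uL; have /l2predP[mu _] := uL.
apply: (@l2pred_le _ (fun t => 2 * c ^+ 2 + 2 * c ^+ 2 * `|u t| ^+ 2)).
- by apply: (@measurableT_comp _ _ _ _ (borelType X) (borelType X)).
- exact: integrable_affine_sqr_norm.
move=> t _; apply: (@le_trans _ _ ((c * (1 + `|u t|)) ^+ 2)).
  rewrite ler_pXn2r ?nnegrE ?hc//; exact: le_trans (hc _).
(* This is (1 + y)^2 <= 2 + 2 y^2, multiplied by c^2. *)
have := mulr_ge0 (sqr_ge0 c) (sqr_ge0 (1 - `|u t|)).
by move: `|u t| => y; rewrite exprMn; lra.
Qed.

Lemma l2pred_if u v (b : R -> bool) : measurable_fun I (b : measurableTypeR R -> bool) ->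
  u \in SqInt -> v \in SqInt -> (fun t => if b t then u t else v t) \in SqInt.
Proof.
move=> mb /l2predP[mu iu] /l2predP[mv iv].
apply: (@l2pred_le _ (fun t => `|u t| ^+ 2 + `|v t| ^+ 2)).
- apply: measurable_fun_if => //; first exact: mI.
    exact: (measurable_funS mI (@subIsetl _ _ _) mu).
  exact: (measurable_funS mI (@subIsetl _ _ _) mv).
- rewrite (_ : _ \o _ = ((fun t => (`|u t| ^+ 2)%:E) \+ (fun t => (`|v t| ^+ 2)%:E))%E)//.
  by apply: (@integrableD _ _ _ leb) => //; exact: mI.
by move=> t _; case: ifP => _; rewrite ?lerDl ?lerDr sqr_ge0.
Qed.

Variables (f : X -> R) (K : R).
Hypothesis mf : measurable_fun [set: borelType X] (f : borelType X -> R).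
Hypothesis fK : forall x, `|f x| <= K * (1 + `|x| ^+ 2).

Lemma integrable_comp_l2 u : u \in SqInt -> (@leb R).-integrable I (EFin \o (f \o u)).
Proof.
move=> uL; have /l2predP[mu iu] := uL.
have i2 := integrable_affine_sqr_norm K K uL.
apply: le_integrable i2; [exact: mI| |].
  apply/measurable_EFinP; apply: (@measurableT_comp _ _ _ _ (borelType X)) => //.
move=> t It; rewrite !abse_EFin lee_fin.
by apply: le_trans (fK (u t)) _; rewrite mulrDr mulr1; exact: ler_norm.
Qed.

Lemma integrable_sqr_distance_l2 u v : u \in SqInt -> v \in SqInt ->
  (@leb R).-integrable I (EFin \o (fun t => `|u t - v t| ^+ 2)).
Proof.
move=> uL vL; have /l2predP[] // : u - v \in SqInt by rewrite rpredB.
Qed.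

(** Stated for plain functions rather than classes, so that it applies to pointwise constructions
    such as h \o v; [eq_penalized_ae] allows the passage to classes. *)
Definition penalized v (l : R) u : R :=
  \int[leb]_(t in I) (`|u t - v t| ^+ 2) + l * \int[leb]_(t in I) f (u t).

Lemma penalizedE v l u : v \in SqInt -> u \in SqInt ->
  penalized v l u = \int[leb]_(t in I) (`|u t - v t| ^+ 2 + l * f (u t)).
Proof.
move=> vL uL; have iu := integrable_comp_l2 uL.
rewrite RintegralD; [|exact: mI|exact: integrable_sqr_distance_l2|].
  by rewrite RintegralZl//; exact: mI.
exact: (@integrableZl _ _ _ leb I mI l _ iu).
Qed.

Lemma integrable_penalized v l u : v \in SqInt -> u \in SqInt ->
  (@leb R).-integrable I (EFin \o (fun t => `|u t - v t| ^+ 2 + l * f (u t))).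
Proof.
move=> vL uL; have iu := integrable_comp_l2 uL.
rewrite (_ : _ \o _ = (EFin \o (fun t => (`|u t - v t| ^+ 2)%R)) \+
    (EFin \o (fun t => (l * f (u t))%R)))%E//.
apply: (@integrableD _ _ _ leb); [exact: mI|exact: integrable_sqr_distance_l2|].
exact: (@integrableZl _ _ _ leb I mI l _ iu).
Qed.

Lemma le_penalized v l u w : v \in SqInt -> u \in SqInt -> w \in SqInt ->
  (forall t, I t -> `|w t - v t| ^+ 2 + l * f (w t) <= `|u t - v t| ^+ 2 + l * f (u t)) ->
  penalized v l w <= penalized v l u.
Proof.
move=> vL uL wL wu; rewrite !penalizedE//.
by apply: le_Rintegral => //; [exact: mI|exact: integrable_penalized..].
Qed.

Lemma eq_penalized v l u w : v \in SqInt -> u \in SqInt -> w \in SqInt ->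
  (forall t, I t -> `|w t - v t| ^+ 2 + l * f (w t) <= `|u t - v t| ^+ 2 + l * f (u t)) ->
  penalized v l u <= penalized v l w ->
  (fun t => `|w t - v t| ^+ 2 + l * f (w t)) =
    (fun t => `|u t - v t| ^+ 2 + l * f (u t)) %[ae leb in I].
Proof.
move=> vL uL wL wu; rewrite !penalizedE// => uw.
by apply: ae_eq_of_ge_Rintegral => //; exact: integrable_penalized.
Qed.

Lemma eq_penalized_ae v v' l u u' : v \in SqInt -> v' \in SqInt -> u \in SqInt -> u' \in SqInt ->
  v = v' %[ae leb in I] -> u = u' %[ae leb in I] -> penalized v l u = penalized v' l u'.
Proof.
move=> vL vL' uL uL' vv uu; rewrite !penalizedE//.
apply: eq_Rintegral_ae; [exact: integrable_penalized..|].
by apply: (@filterS2 _ _ aeF _ _ _ _ vv uu) => t vt ut It; rewrite vt// ut.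
Qed.

(** [h (v t)] minimizes the integrand at every t, hence the integral. If u does as well, the
    integrands agree almost everywhere, and uniqueness at each point gives u = h \o v. *)
Lemma comp_minimizer v l (h : X -> X) : v \in SqInt -> h \o v \in SqInt ->
  (forall y x, `|h y - y| ^+ 2 + l * f (h y) <= `|x - y| ^+ 2 + l * f x) ->
  (forall y x, `|x - y| ^+ 2 + l * f x <= `|h y - y| ^+ 2 + l * f (h y) -> x = h y) ->
  forall u, u \in SqInt -> penalized v l (h \o v) <= penalized v l u /\
    (penalized v l u <= penalized v l (h \o v) -> u = h \o v %[ae leb in I]).
Proof.
move=> vL hvL hmin huniq u uL; split.
  by apply: le_penalized => // t _; exact: hmin.
move=> uh; have := eq_penalized vL uL hvL (fun t _ => hmin (v t) (u t)) uh.
apply: (@filterS _ _ aeF) => t hu It; apply: huniq; have := hu It.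
by rewrite /comp => <-.
Qed.

(** Conversely, a minimizer of the integral minimizes the integrand almost everywhere. Comparison
    with the countably many competitors [h n \o v] costs only one null set, and they approach the
    pointwise infimum. *)
Lemma pointwise_minimizer v l u (h : nat -> X -> X) : v \in SqInt -> u \in SqInt ->
  (forall n, h n \o v \in SqInt) ->
  (forall w, w \in SqInt -> penalized v l u <= penalized v l w) ->
  (forall y x (e : R), 0 < e ->
    exists n, `|h n y - y| ^+ 2 + l * f (h n y) <= `|x - y| ^+ 2 + l * f x + e) ->
  \forall t \ae (@leb R), I t ->
    forall x, `|u t - v t| ^+ 2 + l * f (u t) <= `|x - v t| ^+ 2 + l * f x.
Proof.
move=> vL uL hL umin happ.
pose psi t x := `|x - v t| ^+ 2 + l * f x.
have uh n : \forall t \ae (@leb R), I t -> psi t (u t) <= psi t (h n (v t)).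
  pose b t := psi t (h n (v t)) < psi t (u t).
  (* w changes u exactly where [h n \o v] lowers the integrand; minimality of u makes this set
     null. *)
  pose w t := if b t then (h n \o v) t else u t.
  have mpsi z : z \in SqInt -> measurable_fun I ((fun t => psi t (z t)) : measurableTypeR R -> R).
    by move=> zL; apply/measurable_EFinP; exact: measurable_int (integrable_penalized l vL zL).
  have wL : w \in SqInt.
    apply: l2pred_if => //; apply: measurable_fun_ltr; last exact: mpsi.
    exact: (mpsi _ (hL n)).
  have wu t : I t -> psi t (w t) <= psi t (u t).
    by move=> _; rewrite /w; case: ifPn => // /ltW.
  have := eq_penalized vL uL wL wu (umin _ wL).
  apply: (@filterS _ _ aeF) => t wut It.
  have := wut It; rewrite -[_ = _]/(psi t (w t) = psi t (u t)) /w.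
  by case: ifPn => [hu e|]; [move: hu; rewrite /b -e ltxx|rewrite -leNgt].
have : \forall t \ae (@leb R), forall n, I t -> psi t (u t) <= psi t (h n (v t)).
  exact: ae_foralln.
apply: (@filterS _ _ aeF) => t ut It x; apply/ler_addgt0Pr => e e0.
by have [n] := happ (v t) x e e0; apply: le_trans; exact: ut.
Qed.

End L2_functional.

(** * Multipliers, nearest points and extended real bounds *)

Lemma global_minimumP (R : realType) (T : Type) (F : T -> R) (x : T) :
  global_minimum F x <-> forall z, F x <= F z.
Proof.
split=> [xmin z|xmin].
  by rewrite -lee_fin xmin; apply: ereal_inf_lbound; exists z.
apply/eqP; rewrite eq_le; apply/andP; split.
  by apply/ereal_infP => _ [z _ <-]; rewrite lee_fin.
by apply: ereal_inf_lbound; exists x.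
Qed.

Lemma compactness_like_sub (Y : Type) (F G : set (set Y)) :
  F `<=` G -> compactness_like G -> compactness_like F.
Proof. by move=> FG cG H HF; apply: cG; exact: subset_trans FG. Qed.

(** Test each minimizer against the other and add the two inequalities; the N terms cancel. *)
Lemma minimizer_slope_le (R : realType) (U : Type) (N J : U -> R) (w w' : U) (l l' : R) :
  l < l' -> (forall u, N w + l * J w <= N u + l * J u) ->
  (forall u, N w' + l' * J w' <= N u + l' * J u) -> J w' <= J w.
Proof.
move=> ll /(_ w') h /(_ w) h'.
have : (l' - l) * J w' <= (l' - l) * J w by rewrite !mulrBl; lra.
by rewrite ler_pM2l// subr_gt0.
Qed.

(** Sufficiency of a Lagrange multiplier: as l >= 0, passing to u does not raise the term l J, so it
    cannot lower N. *)
Lemma minimizer_level_nearest (R : realType) (U : Type) (N J : U -> R) (w : U) (l : R) :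
  0 <= l -> (forall u, N w + l * J w <= N u + l * J u) ->
  forall u, J u <= J w -> N w <= N u.
Proof.
move=> l0 wmin u uw; have := wmin u.
have : l * J u <= l * J w by rewrite ler_wpM2l.
lra.
Qed.

Lemma chebyshev_point (R : realType) (H : innerType R) (C : set H) (x y : H) :
  C y -> (forall z, C z -> `|x - y| <= `|x - z|) ->
  (forall z, C z -> `|x - z| <= `|x - y| -> z = y) ->
  exists! y, C y /\ `|x - y| = inf [set `|x - z| | z in C].
Proof.
move=> Cy ymin yuniq.
have infE : inf [set `|x - z| | z in C] = `|x - y|.
  apply/eqP; rewrite eq_le; apply/andP; split.
    apply: ge_inf; last by exists y.
    by exists 0 => _ [z _ <-].
  by apply: lb_le_inf; [exists `|x - y|, y|move=> _ [z Cz <-]; exact: ymin].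
exists y; split; first by rewrite infE.
by move=> z [Cz]; rewrite infE => xz; rewrite (yuniq z)// xz.
Qed.

Lemma between_EFin (R : realType) (s : R) (g : \bar R) : (s%:E < g)%E ->
  exists2 t, s < t & (t%:E < g)%E.
Proof.
case: g => [g||//]; last by exists (s + 1); rewrite ?ltry ?ltrDl.
by rewrite lte_fin => sg; exists ((s + g) / 2); rewrite ?lte_fin; lra.
Qed.

(** * Minimization in L2 by pointwise minimization *)

Section L2_minimization.
Variables (R : realType) (X : separableHilbertType R).
Local Notation I := (unit_itv R).
Local Notation mI := (@measurable_unit_itv R).
Local Notation aeF := (ae_filter_ringOfSetsType (@leb R)).
Local Notation SqInt := (@l2pred R X).
Local Notation L2 := (L2 X).
Implicit Types U V W Z : L2.

Lemma l2repr_l2pred U : l2repr U \in SqInt.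
Proof. exact: l2fun_valP. Qed.

Lemma l2pred_lift u : u \in SqInt -> exists U : L2, l2repr U = u %[ae leb in I].
Proof.
by move=> uL; exists (\pi_(L2)%qT (L2Fun uL)); exact: l2repr_pi.
Qed.

Lemma sqr_distance_L2 U V :
  `|U - V| ^+ 2 = \int[leb]_(t in I) (`|U t - V t| ^+ 2).
Proof.
rewrite (inner_norm (U - V)).
transitivity (\int[leb]_(t in I) (`|(U - V : L2) t| ^+ 2)).
  by apply: eq_Rintegral => t _; rewrite inner_norm.
apply: eq_Rintegral_ae; [exact: l2repr_integrable| |].
  by apply: integrable_sqr_distance_l2; exact: l2repr_l2pred.
have := L2P (-1) V U; rewrite scaleN1r addrC.
apply: (@filterS _ _ aeF) => t UVt It; rewrite UVt//.
by rewrite -[(_ + _) t]/(-1 *: V t + U t) scaleN1r addrC.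
Qed.

Variables (f : X -> R) (K : R).
Hypothesis mf : measurable_fun [set: borelType X] (f : borelType X -> R).
Hypothesis fK : forall x, `|f x| <= K * (1 + `|x| ^+ 2).

Lemma Rintegral_lift U u : u \in SqInt -> l2repr U = u %[ae leb in I] ->
  \int[leb]_(t in I) f (U t) = \int[leb]_(t in I) f (u t).
Proof.
move=> uL Uu; apply: eq_Rintegral_ae.
- exact: (integrable_comp_l2 mf fK (l2repr_l2pred U)).
- exact: (integrable_comp_l2 mf fK uL).
by apply: (@filterS _ _ aeF _ _ _ Uu) => t /[apply] ->.
Qed.

(** Since [0, 1] has measure 1, constant functions make every value of f a value of J. *)
Lemma Rintegral_lift_cst x : exists U : L2, \int[leb]_(t in I) f (U t) = f x.
Proof.
have xL := l2pred_cst x; have [U Ux] := l2pred_lift xL; exists U.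
rewrite (Rintegral_lift xL Ux).
rewrite -[LHS]/(\int[leb]_(_ in I) f x).
rewrite Rintegral_cst; last exact: mI.
by rewrite /= lebesgue_measure_itv/= lte01 oppr0 adde0 mulr1.
Qed.

Variables (gamma : \bar R) (xhat : X -> R -> X).
Hypothesis xhat_min : forall (y : X) (l : R), 0 < l -> (l%:E < gamma)%E ->
  unique (global_minimum (fun x : X => `|x - y| ^+ 2 + l * f x)) (xhat y l).
Hypothesis xhat_growth : forall l : R, 0 < l -> (l%:E < gamma)%E ->
  measurable_fun [set: borelType X]
    ((fun y => xhat y l) : borelType X -> borelType X) /\
  exists c : R, forall y : X, `|xhat y l| <= c * (1 + `|y|).

Let xhat_le y x l : 0 < l -> (l%:E < gamma)%E ->
  `|xhat y l - y| ^+ 2 + l * f (xhat y l) <= `|x - y| ^+ 2 + l * f x.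
Proof. by move=> l0 lg; have [/global_minimumP] := xhat_min y l0 lg. Qed.

Lemma xhat_l2 v l : 0 < l -> (l%:E < gamma)%E -> v \in SqInt ->
  (fun y => xhat y l) \o v \in SqInt.
Proof.
by move=> l0 lg vL; have [mx [c xc]] := xhat_growth l0 lg; exact: l2pred_comp xc vL.
Qed.

(** W is the class of t to [xhat (V t) l], square integrable by measurability and linear growth of
    [xhat] in y. *)
Lemma exists_L2_minimizer V l : 0 < l -> (l%:E < gamma)%E -> exists W, forall Z,
  penalized f V l W <= penalized f V l Z /\
  (penalized f V l Z <= penalized f V l W -> Z = W).
Proof.
move=> l0 lg; have hL := xhat_l2 l0 lg (l2repr_l2pred V).
have [W Wh] := l2pred_lift hL; exists W => Z.
have -> : penalized f V l W = penalized f V l ((fun y => xhat y l) \o V).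
  by apply: (eq_penalized_ae mf fK l) => //; [exact: l2repr_l2pred..|exact: ae_eq_refl].
have xuniq y x : `|x - y| ^+ 2 + l * f x <= `|xhat y l - y| ^+ 2 + l * f (xhat y l) ->
    x = xhat y l.
  move=> xy; have [_ /(_ x)xu] := xhat_min y l0 lg; apply/esym/xu.
  by apply/global_minimumP => z; exact: le_trans xy (xhat_le _ _ l0 lg).
have [hmin huniq] := comp_minimizer mf fK (l2repr_l2pred V) hL
  (fun y x => xhat_le y x l0 lg) xuniq (l2repr_l2pred Z).
split => // /huniq ZW; apply/L2_eqP.
by apply: (@filterS2 _ _ aeF _ _ _ _ ZW Wh) => t Zt Wt It; rewrite Zt// Wt.
Qed.

Variable r : R.
Hypothesis no_min : (gamma < +oo)%E -> forall y : X, r < f y ->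
  ~ exists x : X, global_minimum (fun x : X => `|x - y| ^+ 2 + fine gamma * f x) x.

(* As l increases to gamma, xhat y l is a minimizing sequence for the limit
   problem, because f (xhat y l) is bounded above; so an L2 minimizer of the limit
   problem would be pointwise almost everywhere minimizing. *)
Lemma no_L2_minimizer V (g : R) : gamma = g%:E -> 0 < g ->
  r < \int[leb]_(t in I) f (V t) ->
  ~ exists U, forall Z, penalized f V g U <= penalized f V g Z.
Proof.
move=> gE g0 rV [U Umin].
(* Multipliers increasing to g; the denominator n + 2 keeps the first one, g / 2, positive. *)
pose ln n : R := g - g / n.+2%:R.
have ln0 n : 0 < ln n.
  by rewrite subr_gt0 ltr_pdivrMr// ltr_pMr// ltr1n.
have lng n : ((ln n)%:E < gamma)%E.
  by rewrite gE lte_fin gtrBl divr_gt0.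
have VL := l2repr_l2pred V; have UL := l2repr_l2pred U.
have : \forall t \ae leb, I t ->
    forall x, `|U t - V t| ^+ 2 + g * f (U t) <= `|x - V t| ^+ 2 + g * f x.
  apply: (pointwise_minimizer mf fK (h := fun n y => xhat y (ln n))) => //.
  - by move=> n; exact: xhat_l2.
  - move=> w wL; have [W Ww] := l2pred_lift wL.
    rewrite -(eq_penalized_ae mf fK g VL VL (l2repr_l2pred W) wL _ Ww)//.
    exact: ae_eq_refl.
  move=> y x e e0.
  (* As f (xhat y l) does not increase with l, M bounds [f (xhat y (ln n)) - f x] for all n.
     Replacing [ln n] by g thus costs at most g M / (n + 2). *)
  pose M := `|f (xhat y (ln 0%N)) - f x|.
  have M0 : 0 <= M := normr_ge0 _.
  have [n nM] : exists n, g * M / n.+2%:R <= e.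
    (* The added 1 keeps the divisor positive when M = 0. *)
    have [n _] := near_infty_natSinv_lt
      (PosNum (divr_gt0 e0 (ltr_wpDl (mulr_ge0 (ltW g0) M0) ltr01))).
    move=> /(_ n.+1 (leqnSn n))/= nM; exists n; have gM0 := mulr_ge0 (ltW g0) M0.
    apply: (@le_trans _ _ ((g * M + 1) / n.+2%:R)).
      by rewrite ler_pM2r ?invr_gt0// lerDl.
    rewrite mulrC -ler_pdivlMr; first exact: ltW.
    by rewrite ltr_wpDl.
  exists n.
  have fle : f (xhat y (ln n)) <= f (xhat y (ln 0%N)).
    case: n {nM} => [//|n].
    apply: (minimizer_slope_le (N := fun z => `|z - y| ^+ 2)
      (l := ln 0%N) (l' := ln n.+1)) => [|z|z].
    - by rewrite ltrD2l ltrN2 ltr_pM2l// ltf_pV2 ?posrE// ltr_nat.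
    - exact: xhat_le.
    - exact: xhat_le.
  have := xhat_le y x (ln0 n) (lng n).
  have : (g / n.+2%:R) * (f (xhat y (ln n)) - f x) <= (g / n.+2%:R) * M.
    rewrite ler_pM2l ?divr_gt0//; apply: le_trans (ler_norm _).
    by rewrite lerD2r.
  rewrite /ln; move: nM; rewrite mulrAC; move: (g / _) => d; lra.
(* Wherever U t is a pointwise minimizer, [no_min] excludes r < f (V t); integration then gives J V
   <= r. *)
move=> Uae; move: rV; apply/negP; rewrite -leNgt.
have iV := integrable_comp_l2 mf fK VL.
apply: (@le_trans _ _ (\int[leb]_(t in I) r)); last first.
  rewrite Rintegral_cst; last exact: mI.
  by rewrite /= lebesgue_measure_itv/= lte01 oppr0 adde0 mulr1.
apply: ae_le_Rintegral => //; first exact: integrable_cst_unit_itv.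
apply: (@filterS _ _ aeF _ _ _ Uae) => t Ut It; rewrite leNgt; apply/negP => rf.
have gy : (gamma < +oo)%E by rewrite gE ltry.
apply: (no_min gy rf); exists (U t); rewrite gE/=.
by apply/global_minimumP => x; exact: Ut.
Qed.

(** * The critical multiplier and the Chebyshev property *)

Local Notation J U := (\int[leb]_(t in I) f (U t)).

Hypothesis gamma_gt0 : (0 < gamma)%E.
Hypothesis inf_f_lt : (ereal_inf [set (f x)%:E | x in [set: X]] < r%:E)%E.

Lemma exists_L2_lt : exists U, J U < r.
Proof.
have [_ [x _ <-]] := ereal_inf_lt inf_f_lt; rewrite lte_fin => fx.
by have [U Ux] := Rintegral_lift_cst x; exists U; rewrite Ux.
Qed.

Lemma exists_minimizer_at_level V : r < J V ->
  compactness_like [set A : set L2 | exists l rho : R,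
    [/\ 0 < l, (l%:E < gamma)%E & A = [set U | penalized f V l U <= rho]]] ->
  exists (l : R) W, [/\ 0 < l, J W = r & forall Z,
    penalized f V l W <= penalized f V l Z /\
    (penalized f V l Z <= penalized f V l W -> Z = W)].
Proof.
move=> rV cpt.
pose N U := \int[leb]_(t in I) (`|U t - V t| ^+ 2).
have : forall l : R, exists W, 0 < l -> (l%:E < gamma)%E -> forall Z,
    penalized f V l W <= penalized f V l Z /\
    (penalized f V l Z <= penalized f V l W -> Z = W).
  (* Outside ]0, gamma[ nothing is required, and V serves as a default. *)
  move=> l; have [l0|_] := boolP (0 < l); last by exists V.
  have [lg|_] := boolP (l%:E < gamma)%E; last by exists V.
  by have [W HW] := exists_L2_minimizer V l0 lg; exists W.
move=> /choice[w wP].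
have cptab a b : 0 <= a -> (forall l, l < b -> (l%:E < gamma)%E) ->
    compactness_like [set A : set L2 | exists l rho : R,
      a < l < b /\ A = [set U | N U + l * J U <= rho]].
  move=> a0 bg; apply: compactness_like_sub cpt => A [l [rho [/andP[al lb] AE]]].
  by exists l, rho; split => //; [exact: le_lt_trans al|exact: bg].
have wmin l : 0 < l -> (l%:E < gamma)%E -> forall U, N (w l) + l * J (w l) <= N U + l * J U.
  by move=> l0 lg U; have [] := wP l l0 lg U.
pose S := [set l : R | [/\ 0 < l, (l%:E < gamma)%E & J (w l) <= r]].
(* If S were empty, a finite gamma would admit a minimizer, against [no_L2_minimizer]; an infinite
   one is excluded by a large multiplier. *)
have S0 : S !=set0.
  apply: contrapT => Sempty.
  have rw l : 0 < l -> (l%:E < gamma)%E -> r < J (w l).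
    by move=> l0 lg; rewrite ltNge; apply/negP => wr; apply: Sempty; exists l.
  case: gamma gamma_gt0 rw wmin cptab (@no_L2_minimizer V) => [g||]//.
  - rewrite lte_fin => g0 rw wm cg /(_ g erefl g0 rV); apply.
    have [U [Umin _]] : exists U, (forall Z, N U + g * J U <= N Z + g * J Z) /\ r <= J U.
      apply: (minimizer_right_endpoint (w := w) (a := 0)) => //.
      + by move=> l /andP[l0 lg]; apply: wm.
      + by move=> l /andP[l0 lg]; apply/ltW/rw.
      + by apply: cg => // l; rewrite lte_fin.
    by exists U.
  - move=> _ rw wm _ _; have [U Ur] := exists_L2_lt.
    have d0 : 0 < r - J U by rewrite subr_gt0.
    have N0 Z : 0 <= N Z by apply: Rintegral_ge0 => t _; exact: sqr_ge0.
    (* Chosen so that l r exceeds N U + l J U by 1, which contradicts minimality of [w l] if J (w l)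
       > r. *)
    pose l := (N U + 1) / (r - J U).
    have l0 : 0 < l by rewrite divr_gt0// ltr_wpDl.
    have := wm l l0 (ltry _) U; have := N0 (w l).
    have : l * r < l * J (w l) by rewrite ltr_pM2l// rw// ltry.
    have : l * (r - J U) = N U + 1 by rewrite divfK// gt_eqF.
    rewrite mulrBr; lra.
have Slb : has_lbound S by exists 0 => l [/ltW].
pose l0 := inf S.
have l0_ge0 : 0 <= l0 by apply: lb_le_inf => // l [/ltW].
have [s0 [s0_gt0 s0g s0r]] := S0.
have l0s0 : l0 <= s0 by apply: ge_inf.
have l0g : (l0%:E < gamma)%E by apply: le_lt_trans s0g; rewrite lee_fin.
have ltg l l' : l <= l' -> (l'%:E < gamma)%E -> (l%:E < gamma)%E.
  by move=> ll; apply: le_lt_trans; rewrite lee_fin.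
(* Monotonicity of J along w makes S upward closed below gamma, so J (w l) <= r on all of ]l0,
   s1[. *)
have [s1 l0s1 s1g] := between_EFin l0g.
have [U [Umin Ur]] : exists U, (forall Z, N U + l0 * J U <= N Z + l0 * J Z) /\ J U <= r.
  apply: (minimizer_left_endpoint (w := w) (b := s1)) => //.
  - move=> l /andP[ll ls]; apply: wmin; first exact: le_lt_trans ll.
    exact: ltg _ _ (ltW ls) s1g.
  - move=> l /andP[ll ls]; have [s [s_gt0 sg sr] sl] := inf_lt S0 ll.
    apply: le_trans sr; apply: (minimizer_slope_le (N := N) (J := fun U : L2 => J U)
      (w := w s) (w' := w l) sl); first exact: wmin.
    by apply: wmin; [exact: le_lt_trans ll|exact: ltg _ _ (ltW ls) s1g].
  - by apply: cptab => // l ls; exact: ltg _ _ (ltW ls) s1g.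
(* At multiplier 0, U would minimize the distance to V, hence equal V, although J U <= r < J V. *)
have l0_gt0 : 0 < l0.
  rewrite lt_neqAle l0_ge0 andbT; apply/eqP => l00.
  have NV : N V = 0.
    by rewrite /N -sqr_distance_L2 subrr normr0 expr0n.
  have := Umin V; rewrite -l00 !mul0r !addr0 NV /N -sqr_distance_L2 => UV.
  have : U = V.
    apply/eqP; rewrite -subr_eq0 -normr_eq0 -sqrf_eq0.
    by rewrite eq_le UV sqr_ge0.
  by move=> UVE; move: rV; rewrite ltNge -UVE Ur.
have [U' [Umin' Ur']] : exists U, (forall Z, N U + l0 * J U <= N Z + l0 * J Z) /\ r <= J U.
  apply: (minimizer_right_endpoint (w := w) (a := 0)) => //.
  - by move=> l /andP[ll ls]; apply: wmin => //; exact: ltg _ _ (ltW ls) l0g.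
  - move=> l /andP[ll ls]; rewrite leNgt; apply/negP => wr.
    have : S l by split => //; [exact: ltg _ _ (ltW ls) l0g|exact: ltW].
    by move=> /(ge_inf Slb); rewrite leNgt ls.
  - by apply: cptab => // l ls; exact: ltg _ _ (ltW ls) l0g.
(* Uniqueness at l0 identifies both endpoint minimizers with [w l0], so J (w l0) is both at most and
   at least r. *)
have [_ /(_ (Umin _)) UE] := wP l0 l0_gt0 l0g U.
have [_ /(_ (Umin' _)) UE'] := wP l0 l0_gt0 l0g U'.
exists l0, (w l0); split => //; last exact: wP.
by apply/eqP; rewrite eq_le -{1}UE Ur -UE'.
Qed.

Lemma chebyshev_sublevel :
  (forall V, r < J V -> compactness_like [set A : set L2 | exists l rho : R,
    [/\ 0 < l, (l%:E < gamma)%E & A = [set U | penalized f V l U <= rho]]]) ->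
  chebyshev_set [set U : L2 | J U <= r].
Proof.
move=> cpt; split; first by have [U /ltW] := exists_L2_lt; exists U.
move=> x; pose V : L2 := x; rewrite -/V; have [Vr|rV] := leP (J V) r.
  apply: (@chebyshev_point _ _ _ V V) => // [z _|z _]; first by rewrite subrr normr0.
  by rewrite subrr normr0 normr_le0 subr_eq0 => /eqP.
have [l [W [l0 Wr WP]]] := exists_minimizer_at_level rV (cpt V rV).
have distE (U : L2) : `|V - U| ^+ 2 = \int[leb]_(t in I) (`|U t - V t| ^+ 2).
  by rewrite distrC sqr_distance_L2.
have leE (U Z : L2) : (`|V - U| <= `|V - Z|) = (`|V - U| ^+ 2 <= `|V - Z| ^+ 2).
  by rewrite ler_pXn2r ?nnegrE.
apply: (@chebyshev_point _ _ _ V W); first by rewrite /= Wr.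
  move=> Z /= Zr; rewrite leE !distE.
  apply: (minimizer_level_nearest (N := fun U : L2 => \int[leb]_(t in I) (`|U t - V t| ^+ 2))
    (J := fun U => J U) (ltW l0)); last by rewrite Wr.
  by move=> U; have [] := WP U.
(* With J Z <= r = J W and Z no farther than W, Z is also a penalized minimizer, hence W. *)
move=> Z /= Zr; rewrite leE !distE => ZW; have [_] := WP Z; apply.
by rewrite /penalized lerD// ler_pM2l// Wr.
Qed.

End L2_minimization.

(** * Integrals of step functions *)

Lemma Rintegral_add_step (R : realType) (g : R -> R) (k c : R) : 0 <= c -> c <= 1 ->
  (@leb R).-integrable (unit_itv R) (EFin \o g) ->
  let h := fun t => g t + k * (if t < c then 1 else 0) in
  (@leb R).-integrable (unit_itv R) (EFin \o h) /\
  \int[leb]_(t in unit_itv R) h t = \int[leb]_(t in unit_itv R) g t + k * c.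
Proof.
move=> c0 c1 ig h; have mI := @measurable_unit_itv R.
pose chi (t : R) : R := if t < c then 1 else 0.
have ichi : (@leb R).-integrable (unit_itv R) (EFin \o chi).
  apply: (@le_integrable _ _ _ leb _ mI _ (fun=> 1%E)); last exact: integrable_cst_unit_itv.
    by apply/measurable_EFinP; apply: measurable_fun_if => //; exact: measurable_fun_ltr.
  by move=> t _ /=; rewrite /chi; case: ifP; rewrite ?normr1 ?normr0 lee_fin.
have ikchi : (@leb R).-integrable (unit_itv R) (EFin \o (fun t => k * chi t)).
  exact: (@integrableZl _ _ _ leb _ mI k _ ichi).
split.
  rewrite (_ : _ \o _ = (EFin \o g) \+ (EFin \o (fun t => (k * chi t)%R)))%E//.
  exact: integrableD.
rewrite RintegralD// RintegralZl//; congr (_ + k * _).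
have mc : measurable ([set` `]-oo, c[] : set (measurableTypeR R)) by exact: measurable_itv.
transitivity (fine (\int[leb]_(t in unit_itv R) (\1_[set` `]-oo, c[] t)%:E)).
  congr fine; apply: eq_integral => t _; rewrite indicE /chi mem_setE in_itv/=.
  by case: (t < c).
rewrite integral_indic//.
rewrite (_ : _ `&` _ = [set` `[0, c[]); last first.
  rewrite /unit_itv; apply/seteqP; split => t /=; rewrite !in_itv/=.
    by move=> [-> /andP[->]].
  by move=> /andP[-> tc]; rewrite tc (le_trans (ltW tc) c1).
rewrite /= lebesgue_measure_itv/= lte_fin; case: ltP => c0'; first by rewrite -EFinB subr0.
by apply/eqP; rewrite eq_le c0 c0'.
Qed.

(** In use, x and y fill two equal short pieces, while p and q fill the rest in proportions that
    adjust the integral of f. *)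
Definition step (R : realType) (T : Type) (a b c : R) (x y p q : T) (t : R) : T :=
  if t < a then x else if t < b then y else if t < c then p else q.

Lemma Rintegral_step (R : realType) (a b c k1 k2 k3 k4 : R) :
  0 <= a -> a <= b -> b <= c -> c <= 1 ->
  \int[leb]_(t in unit_itv R) step a b c k1 k2 k3 k4 t =
  a * k1 + (b - a) * k2 + (c - b) * k3 + (1 - c) * k4.
Proof.
move=> a0 ab bc c1; have mI := @measurable_unit_itv R.
(* The step function is the constant k4 plus the jumps k1 - k2, k2 - k3 and k3 - k4 on [0, a[, [0,
   b[ and [0, c[. *)
have [||i1 e1] := Rintegral_add_step (k1 - k2) _ _ (integrable_cst_unit_itv k4) (c := a); [lra..|].
have [||i2 e2] := Rintegral_add_step (k2 - k3) _ _ i1 (c := b); [lra..|].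
have [||_ e3] := Rintegral_add_step (k3 - k4) _ _ i2 (c := c); [lra..|].
transitivity (a * (k1 - k2) + b * (k2 - k3) + c * (k3 - k4) + k4); last by ring.
move: e3; rewrite e2 e1 Rintegral_cst//= /= lebesgue_measure_itv/= lte01 oppr0 adde0 mulr1 => e3.
rewrite [RHS](_ : _ = k4 + (k1 - k2) * a + (k2 - k3) * b + (k3 - k4) * c); last by ring.
rewrite -e3; apply: eq_Rintegral => t _; rewrite /step /=.
have [ta|ta] := ltP t a.
  by rewrite (lt_le_trans ta ab) (lt_le_trans ta (le_trans ab bc)); ring.
have [tb|tb] := ltP t b; first by rewrite (lt_le_trans tb bc); ring.
by have [tc|tc] := ltP t c; ring.
Qed.

(** * From a convex sublevel set to a convex f *)

Section nonconvexity.
Variables (R : realType) (X : separableHilbertType R).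
Local Notation I := (unit_itv R).
Local Notation mI := (@measurable_unit_itv R).
Local Notation aeF := (ae_filter_ringOfSetsType (@leb R)).
Local Notation SqInt := (@l2pred R X).

Lemma step_l2pred (a b c : R) (x y p q : X) : step a b c x y p q \in SqInt.
Proof.
have mlt (d : R) : measurable_fun I ((fun t => t < d) : measurableTypeR R -> bool).
  exact: measurable_fun_ltr.
by do 3 (apply: l2pred_if => //; first exact: l2pred_cst); exact: l2pred_cst.
Qed.

Variables (f : X -> R) (K : R).
Hypothesis mf : measurable_fun [set: borelType X] (f : borelType X -> R).
Hypothesis fK : forall x, `|f x| <= K * (1 + `|x| ^+ 2).

Lemma convex_sublevel_average (r : R) (u v : R -> X) :
  convex_set ([set U : L2 X | \int[leb]_(t in I) f (U t) <= r] : set (convex_lmodType (L2 X))) ->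
  u \in SqInt -> v \in SqInt ->
  \int[leb]_(t in I) f (u t) <= r -> \int[leb]_(t in I) f (v t) <= r ->
  \int[leb]_(t in I) f (2^-1 *: (u t + v t)) <= r.
Proof.
move=> cC uL vL ur vr.
pose pi (w : l2fun X) : L2 X := \pi_(L2 X)%qT w.
have lift (w : l2fun X) : \int[leb]_(t in I) f (pi w t) = \int[leb]_(t in I) f (w t).
  exact: (Rintegral_lift mf fK (l2fun_valP w) (l2repr_pi w)).
pose U := L2Fun uL; pose V := L2Fun vL.
have h0 : 0 <= 2^-1 :> R by rewrite invr_ge0.
have h1 : 2^-1 <= 1 :> R by rewrite invf_le1// ler1n.
pose h : {i01 R} := Itv01 h0 h1.
have /set_mem : conv h (pi U : convex_lmodType (L2 X)) (pi V : convex_lmodType (L2 X)) \in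
    [set U : L2 X | \int[leb]_(t in I) f (U t) <= r].
  by apply: cC; apply/mem_set; rewrite /= lift.
rewrite -[conv h _ _]/(h%:num *: pi U + (1 - h%:num) *: pi V) /pi.
rewrite -[_ *: _ + _ *: _]/(l2scale _ _ + l2scale _ _) -!pi_l2scale -pi_l2D /= lift.
congr (_ <= _); apply: eq_Rintegral => t _; congr f.
rewrite -[LHS]/(2^-1 *: u t + (1 - 2^-1) *: v t) scalerDr.
by congr (_ + _ *: _); field.
Qed.

Lemma convex_sublevel_midpoint (r : R) (p q : X) : f p < r -> r < f q ->
  convex_set ([set U : L2 X | \int[leb]_(t in I) f (U t) <= r] : set (convex_lmodType (L2 X))) ->
  forall x y, f (2^-1 *: (x + y)) <= (f x + f y) / 2.
Proof.
move=> pr rq cC x y.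
set beta := (f x + f y) / 2.
pose e1 := (r - f p) / (1 + `|beta - f p|).
pose e2 := (f q - r) / (1 + `|f q - beta|).
(* The bounds e1 and e2 are what th <= 1 - e and 0 <= th require below. *)
pose e := Num.min (2^-1) (Num.min e1 e2).
have pos (d : R) : 0 < 1 + `|d| by rewrite ltr_pwDl.
have e0 : 0 < e by rewrite !lt_min invr_gt0 ltr0n !divr_gt0 ?subr_gt0.
have eh : e <= 2^-1 by rewrite ge_min lexx.
have ele (d k : R) : e <= k / (1 + `|d|) -> e * d <= k.
  rewrite ler_pdivlMr// => ed; apply: le_trans ed; rewrite ler_pM2l//.
  by apply: le_trans (ler_norm d) _; rewrite lerDr.
have h1 : e * (beta - f p) <= r - f p by apply: ele; rewrite !ge_min lexx !orbT.
have h2 : e * (f q - beta) <= f q - r by apply: ele; rewrite !ge_min lexx !orbT.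
(* The solution of e beta + th f p + (1 - e - th) f q = r, which gives both step functions J = r. *)
pose th := ((1 - e) * f q - r + e * beta) / (f q - f p).
have qp : 0 < f q - f p by lra.
have thE : th * (f q - f p) = (1 - e) * f q - r + e * beta by rewrite divfK// gt_eqF.
have th0 : 0 <= th by rewrite divr_ge0//; lra.
have th1 : th <= 1 - e by rewrite ler_pdivrMr//; lra.
have fstep x1 x2 : \int[leb]_(t in I) f (step (e / 2) e (e + th) x1 x2 p q t) =
    e * ((f x1 + f x2) / 2) + th * f p + (1 - e - th) * f q.
  transitivity (\int[leb]_(t in I) step (e / 2) e (e + th) (f x1) (f x2) (f p) (f q) t).
    by apply: eq_Rintegral => t _; rewrite /step; do 3 case: ifP => //.
  by rewrite Rintegral_step; [field|lra..].
have mid z : 2^-1 *: (z + z) = z :> X.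
  by rewrite -mulr2n -[z *+ 2]scaler_nat scalerA mulVf ?scale1r// pnatr_eq0.
set z := 2^-1 *: (x + y).
(* Both step functions take the values p and q on the same sets, so averaging changes only [0, e[,
   where it gives z. *)
have avgE : \int[leb]_(t in I) f (2^-1 *: (step (e / 2) e (e + th) x y p q t +
    step (e / 2) e (e + th) y x p q t)) =
    \int[leb]_(t in I) f (step (e / 2) e (e + th) z z p q t).
  apply: eq_Rintegral => t _; congr f; rewrite /step.
  case: (t < e / 2) => //; case: (t < e); first by rewrite [y + x]addrC.
  by case: (t < e + th); rewrite mid.
have := convex_sublevel_average cC (step_l2pred (e / 2) e (e + th) x y p q)
  (step_l2pred (e / 2) e (e + th) y x p q).
rewrite avgE !fstep [f y + f x]addrC -/beta => H.
have rE : e * beta + th * f p + (1 - e - th) * f q = r by lra.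
have : e * ((f z + f z) / 2) <= e * beta by move: H; rewrite rE lexx => /(_ isT isT); lra.
by rewrite ler_pM2l//; lra.
Qed.

End nonconvexity.

(** The Bernstein-Doetsch argument along one segment: midpoint convexity and an upper bound give
    convexity, the bound coming from quadratic growth. *)
Lemma midpoint_convex_function (R : realType) (X : normedModType R) (f : X -> R) (K : R) :
  (forall x, `|f x| <= K * (1 + `|x| ^+ 2)) ->
  (forall x y, f (2^-1 *: (x + y)) <= (f x + f y) / 2) ->
  convex_function [set: convex_lmodType X] f.
Proof.
move=> fK fmid t x y _ _.
pose psi (s : R) := f (s *: x + (1 - s) *: y) - (s * f x + (1 - s) * f y).
pose V := [set psi s | s in [set s | 0 <= s <= 1]].
have psi_mid s s' : psi ((s + s') / 2) <= (psi s + psi s') / 2.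
  have := fmid (s *: x + (1 - s) *: y) (s' *: x + (1 - s') *: y).
  rewrite (_ : 2^-1 *: _ = ((s + s') / 2) *: x + (1 - (s + s') / 2) *: y).
    rewrite /psi; lra.
  rewrite addrACA -!scalerDl scalerDr !scalerA; congr (_ *: _ + _ *: _); lra.
have psi0 : psi 0 = 0 by rewrite /psi scale0r add0r subr0 scale1r; ring.
have psi1 : psi 1 = 0 by rewrite /psi subrr scale0r addr0 scale1r; ring.
have V0 : V !=set0 by exists (psi 0), 0 => //=; rewrite lexx ler01.
have K0 : 0 <= K.
  by have := le_trans (normr_ge0 _) (fK 0); rewrite normr0 expr0n/= addr0 mulr1.
have Vub : has_ubound V.
  exists (K * (1 + (`|x| + `|y|) ^+ 2) + (`|f x| + `|f y|)) => _ [s /= /andP[s0 s1] <-].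
  have s1' : 0 <= 1 - s by rewrite subr_ge0.
  rewrite /psi lerD//.
    apply: le_trans (ler_norm _) _; apply: le_trans (fK _) _.
    rewrite ler_wpM2l// lerD2l ler_pXn2r ?nnegrE ?addr_ge0//.
    apply: le_trans (ler_normD _ _) _; rewrite !normrZ !ger0_norm//.
    by rewrite lerD// ler_piMl//; lra.
  rewrite opprD lerD// -mulrN; apply: le_trans (ler_norm _) _; rewrite normrM normrN ger0_norm//.
    by rewrite ler_piMl//.
  by rewrite ler_piMl//; lra.
(* The chord defect psi is midpoint convex and vanishes at 0 and 1, so it is at
   most half its supremum everywhere. *)
have half s : 0 <= s <= 1 -> psi s <= sup V / 2.
  (* s is the midpoint of 0 and 2 s, or of 1 and 2 s - 1. *)
  move=> /andP[s0 s1]; have [sh|sh] := leP s (2^-1).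
    have : psi (2 * s) <= sup V by apply: ub_le_sup => //; exists (2 * s) => //=; lra.
    have := psi_mid 0 (2 * s); rewrite psi0 (_ : (0 + 2 * s) / 2 = s); [lra|by field].
  have : psi (2 * s - 1) <= sup V by apply: ub_le_sup => //; exists (2 * s - 1) => //=; lra.
  have := psi_mid 1 (2 * s - 1); rewrite psi1 (_ : (1 + (2 * s - 1)) / 2 = s); [lra|by field].
(* A finite supremum at most half of itself is at most 0, hence psi <= 0. *)
have supV : sup V <= sup V / 2 by apply: ge_sup => // _ [s /= s01 <-]; exact: half.
have := half t%:num; rewrite ge0 le1 => /(_ isT) ht.
rewrite -[leLHS]/(f (t%:num *: x + (1 - t%:num) *: y)).
rewrite -[leRHS]/(t%:num * f x + (1 - t%:num) * f y).
by rewrite -subr_le0; apply: le_trans ht _; lra.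
Qed.

Lemma quadratic_growth (R : realType) (X : normedModType R) (f : X -> R) :
  (ereal_sup [set (`|f x| / (1 + `|x| ^+ 2))%:E | x in [set: X]] < +oo)%E ->
  exists K : R, forall x, `|f x| <= K * (1 + `|x| ^+ 2).
Proof.
set s := ereal_sup _ => soo; exists (fine s) => x.
have p0 : 0 < 1 + `|x| ^+ 2 by rewrite ltr_pwDl// sqr_ge0.
have xs : ((`|f x| / (1 + `|x| ^+ 2))%:E <= s)%E.
  by apply: ereal_sup_ubound; exists x.
rewrite -ler_pdivrMr// -lee_fin fineK// fin_numE -ltNye -ltey soo andbT.
exact: lt_le_trans (ltNyr _) xs.
Qed.

Unset Implicit Arguments.

Theorem theorem1 (R : realType) (X : separableHilbertType R)
    (f : X -> R) (r : R) (gamma : \bar R) (xhat : X -> R -> X) :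
  infinite_dimensional X ->
  measurable_fun [set: borelType X] (f : borelType X -> R) ->
  ~ convex_function [set: convex_lmodType X] f ->
  (ereal_inf [set (f x)%:E | x in [set: X]] < r%:E)%E ->
  (r%:E < ereal_sup [set (f x)%:E | x in [set: X]])%E ->
  (0 < gamma)%E ->
  (* (a) *)
  (ereal_sup [set (`|f x| / (1 + `|x| ^+ 2))%:E | x in [set: X]] < +oo)%E ->
  (* (b) *)
  (forall (y : X) (lambda : R), 0 < lambda -> (lambda%:E < gamma)%E ->
    unique (global_minimum (fun x : X => `|x - y| ^+ 2 + lambda * f x))
      (xhat y lambda)) ->
  (forall lambda : R, 0 < lambda -> (lambda%:E < gamma)%E ->
    measurable_fun [set: borelType X]
      ((fun y => xhat y lambda) : borelType X -> borelType X) /\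
    exists c : R, forall y : X, `|xhat y lambda| <= c * (1 + `|y|)) ->
  (* (c) *)
  ((gamma < +oo)%E -> forall y : X, r < f y ->
    ~ exists x : X,
        global_minimum (fun x : X => `|x - y| ^+ 2 + fine gamma * f x) x) ->
  (* (d) *)
  (forall v : L2 X, r < \int[lebesgue_measure]_(t in unit_itv R) f (v t) ->
    compactness_like [set A : set (L2 X) | exists lambda rho : R,
      [/\ 0 < lambda, (lambda%:E < gamma)%E &
          A = [set u : L2 X |
                 (\int[lebesgue_measure]_(t in unit_itv R) (`|u t - v t| ^+ 2)) +
                 lambda * (\int[lebesgue_measure]_(t in unit_itv R) f (u t)) <= rho]]]) ->
  let C := [set u : L2 X | \int[lebesgue_measure]_(t in unit_itv R) f (u t) <= r] in
  ~ convex_set (C : set (convex_lmodType (L2 X))) /\ chebyshev_set C.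
Proof.
move=> _ mf fnonconvex infr rsup g0 /quadratic_growth[K fK] xmin xgrowth nomin cpt C; split.
  move=> cC; apply: fnonconvex.
  (* The strict bounds on r supply p and q with f p < r < f q, used to complete the step
     functions. *)
  have [_ [p _ <-]] := ereal_inf_lt infr; rewrite lte_fin => pr.
  have [_ [q _ <-]] := ereal_sup_gt rsup; rewrite lte_fin => rq.
  exact: midpoint_convex_function fK (convex_sublevel_midpoint mf fK pr rq cC).
exact (chebyshev_sublevel mf fK xmin xgrowth nomin g0 infr cpt).
Qed.
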